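(* Let $d \in \mathbb{N}$ (so $d \ge 1$), let $\mathbb{V}$ be a $d$-dimensional real vector space and let $\mathbb{L}$ be a lattice of rank $d$ in $\mathbb{V}$. Let $T$ be a $d$-dimensional lattice simplex (with respect to $\mathbb{L}$) in $\mathbb{V}$ whose interior contains precisely one point of $\mathbb{L}$. Let $p_0,\ldots,p_d$ be the vertices of $T$ and let $\beta_0,\ldots,\beta_d$ be the barycentric coordinates, with respect to $p_0,\ldots,p_d$, of the unique interior lattice point of $T$. Then, for every partition $(I,J)$ of $\{0,\ldots,d\}$ (that is, $I,J$ nonempty and disjoint with $I \cup J = \{0,\ldots,d\}$), one has $$\sum_{i \in I} \beta_i \ \ge\ \prod_{j \in J} \beta_j.$$
   Context: A lattice polytope (with respect to $\mathbb{L}$) is the convex hull of finitely many points of $\mathbb{L}$; a lattice simplex is a simplex that is a lattice polytope, i.e. all its vertices are in $\mathbb{L}$. The barycentric coordinates of a point $x$ with respect to a simplex with vertices $p_0,\ldots,p_d$ are the unique reals $\alpha_0,\ldots,\alpha_d$ with $x = \sum_{i=0}^d \alpha_i p_i$ and $\sum_{i=0}^d \alpha_i = 1$. *)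

(* Defs.v *)
From HB Require Import structures.
From mathcomp Require Import all_boot all_order all_algebra.
From mathcomp Require Import all_classical all_reals all_analysis.

Set Implicit Arguments.
Unset Strict Implicit.
Unset Printing Implicit Defensive.

Import Order.TTheory GRing.Theory Num.Theory.
Import numFieldNormedType.Exports.

Local Open Scope classical_set_scope.
Local Open Scope ring_scope.

(* A vectType carries no topology of its own. Its usual topology (the only
   Hausdorff vector space topology) is the one pulled back from 'rV[R]_(dim V)
   along the linear bijection v2r; every linear bijection gives the same one. *)
Definition vect_topology (R : realType) (V : vectType R) : Type :=
  initial_topology (VectorInternalTheory.v2r : V -> 'rV[R]_(dim V)).

HB.instance Definition _ (R : realType) (V : vectType R) :=
  Topological.copy (vect_topology V)
    (initial_topology (VectorInternalTheory.v2r : V -> 'rV[R]_(dim V))).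

Definition vect_interior (R : realType) (V : vectType R) (A : set V) : set V :=
  interior (A : set (vect_topology V)).

Definition convex_hull (R : realType) (V : vectType R) (A : set V) : set V :=
  smallest (@convex_set R V) A.

Definition is_lattice (R : realType) (V : vectType R) (r : nat) (L : set V) :=
  exists2 b : r.-tuple V, free b & L = [set v | inIntSpan b v].

Definition affinely_independent (R : realType) (V : vectType R) (m : nat)
    (p : 'I_m -> V) :=
  forall a : 'I_m -> R,
    \sum_i a i = 0 -> \sum_i a i *: p i = 0 -> forall i, a i = 0.

(* T is a k-dimensional simplex whose vertices are p_0, ..., p_k. *)
Definition is_simplex (R : realType) (V : vectType R) (k : nat)
    (p : 'I_k.+1 -> V) (T : set V) :=
  affinely_independent p /\ T = convex_hull (range p).

Definition is_lattice_simplex (R : realType) (V : vectType R) (L : set V)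
    (k : nat) (p : 'I_k.+1 -> V) (T : set V) :=
  is_simplex p T /\ (forall i, L (p i)).

Definition barycentric_coordinates (R : realType) (V : vectType R) (m : nat)
    (p : 'I_m -> V) (x : V) (alpha : 'I_m -> R) :=
  x = \sum_i alpha i *: p i /\ \sum_i alpha i = 1.

(* Main.v *)
(* Let s be the sum of the beta_i over I and suppose s < prod_(j in J) beta_j.
   The vectors u = m beta_J + n in R^J, with m and the n_j integers and
   m + sum_j n_j = 0, form a lattice of determinant s (the last coordinate is
   -m s minus the sum of the others). As the box |u_j| < beta_j has volume more
   than 2^|J| s, Minkowski's theorem yields a nonzero u in it, with m > 0 up to
   sign. The lattice point (1 + m) x + sum_j n_j p_j then has barycentric
   coordinates beta_j + u_j > 0 on J and (1 + m) beta_i > beta_i on I, so it is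
   a second interior lattice point. *)
Require Import Defs.
From mathcomp Require Import all_boot all_order all_algebra.
From mathcomp Require Import all_classical all_reals all_analysis.
From mathcomp Require Import ring lra.

Set Implicit Arguments.
Unset Strict Implicit.
Unset Printing Implicit Defensive.

Import Order.TTheory GRing.Theory Num.Theory.
Import numFieldNormedType.Exports VectorInternalTheory.

Local Open Scope classical_set_scope.
Local Open Scope ring_scope.

(** * Minkowski's theorem for a box, by pigeonhole *)

Lemma prod_addV_lt1 (R : realType) (A : finType) (c e : A -> R) :
  \prod_j c j < 1 -> exists K : nat, \prod_j (c j + e j / K.+1%:R) < 1.
Proof.
move=> c1.
(* The product is a polynomial in the small quantity [1 / K.+1], hence continuous, and its value at
   0 is [\prod_j c j]. *)
pose p : {poly R} := \prod_j ((c j)%:P + e j *: 'X).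
have pE t : p.[t] = \prod_j (c j + e j * t).
  by rewrite horner_prod; apply: eq_bigr => j _; rewrite !hornerE.
have p0 : p.[0] < 1.
  by rewrite pE; under eq_bigr do rewrite mulr0 addr0.
have : p.[harmonic n] @[n --> \oo] --> p.[0].
  by apply: continuous_cvg; [exact: continuous_horner | exact: cvg_harmonic].
move/(@cvgr_lt _ _) => /(_ _ p0)[N _ /(_ N (leqnn N))] /=.
by rewrite pE; exists N.
Qed.

(** The box with sides [w j] is cut into cells with sides [b j], at most [w j / b j + 1] of them in
    direction [j]. There are more points than cells, and two points of one cell differ by less than
    [b j] in each coordinate. *)
Lemma box_pigeonhole (R : realType) (A X : finType) (v : X -> A -> R)
    (b w : A -> R) :
    (forall j, 0 < b j) -> (forall j, 0 <= w j) ->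
    (forall x j, 0 <= v x j < w j) ->
    \prod_j (w j / b j + 1) < #|X|%:R ->
  exists x y, x != y /\ forall j, `|v x j - v y j| < b j.
Proof.
move=> b0 w0 vw X_gt.
pose t x j := Num.truncn (v x j / b j).
pose C j := (Num.truncn (w j / b j)).+1.
pose M := (\max_j C j)%N.
have tC x j : (t x j < C j)%N.
  have /andP[_ /ltW vwj] := vw x j.
  by rewrite ltnS le_truncn// ler_pM2r ?invr_gt0.
have tM x j : (t x j < M.+1)%N.
  by apply: leq_trans (tC x j) _; apply: leqW; apply: leq_bigmax.
(* Finite functions need one codomain for all [j], hence the common bound [M]; the sharper bounds
   [C j] come back through [family] in the count. *)
pose f x := [ffun j => inord (t x j) : 'I_M.+1].
have fE x j : f x j = t x j :> nat by rewrite ffunE inordK.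
have /injectivePn[x [y xy fxy]] : ~~ injectiveb f.
  apply/negP => /injectiveP finj; move: X_gt; apply/negP; rewrite -leNgt.
  have sub : f @: [set: X]%SET \subset
      family (fun j => [pred c : 'I_M.+1 | (c < C j)%N]).
    apply/fintype.subsetP => _ /imsetP[x _ ->]; apply/familyP => j.
    by rewrite inE fE.
  have := subset_leq_card sub.
  rewrite card_imset// cardsT card_family foldrE big_map big_enum/= => XC.
  apply: (@le_trans _ _ (\prod_j C j)%:R).
    rewrite ler_nat (leq_trans XC)//; apply: leq_prod => j _.
    rewrite -sum1_card -(big_ord_widen _ (fun=> 1%N)) ?sum1_card ?card_ord//.
    exact/leqW/leq_bigmax.
  rewrite natr_prod; apply: ler_prod => j _; rewrite ler0n/= /C -natr1 lerD2r.
  by rewrite truncn_le// divr_ge0// ltW.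
exists x, y; split=> // j.
have txy : t x j = t y j by rewrite -!fE fxy.
have tP z : (t z j)%:R <= v z j / b j < (t z j).+1%:R.
  by have /andP[? _] := vw z j; rewrite truncn_itv// divr_ge0// ltW.
have : `|v x j / b j - v y j / b j| < 1.
  have := tP x; have := tP y; rewrite txy -natr1 => /andP[? ?] /andP[? ?].
  by rewrite ltr_norml; apply/andP; split; lra.
rewrite -mulrBl normrM (gtr0_norm (x := (b j)^-1)) ?invr_gt0//.
by rewrite ltr_pdivrMr// mul1r.
Qed.

Lemma sum_predC1 (A : finType) (V : zmodType) (j0 : A) (F : A -> V) :
  \sum_(j | j != j0) F j = \sum_j F j - F j0.
Proof. by rewrite [\sum_j F j](bigD1 j0)//= addrAC subrr add0r. Qed.

(* Minkowski's theorem for a lattice of determinant s. The points x : X index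
   K.+1 ^ #|A| lattice vectors u x lying in a region of volume about
   s * K.+1 ^ #|A|, which is cut into boxes of sides b j; the pigeonhole
   principle applies for K large. *)
Lemma minkowski_box (R : realType) (A : finType) (j0 : A) (b : A -> R) (s : R) :
    (forall j, 0 < b j) -> 0 < s -> s + \sum_j b j = 1 -> s < \prod_j b j ->
  exists (m : int) (n : A -> int),
    [/\ 0 < m, m + \sum_j n j = 0 & forall j, `|m%:~R * b j + (n j)%:~R| < b j].
Proof.
move=> b0 s0 sb1 s_lt.
(* [a] absorbs the rounding errors of the coordinates other than [j0], each at most 1. *)
pose a : R := #|A|%:R + 1.
have a1 : 1 <= a by rewrite lerDr.
(* The factors are [(w j / b j + 1) / K.+1] for the sides [w] defined below. As [K] grows their
   product tends to [s / \prod_j b j < 1], so the cells become fewer than the [K.+1 ^ #|A|]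
   points. *)
have [K] : exists K : nat, \prod_j ((if j == j0 then s else 1) / b j +
    (if j == j0 then a / b j + 1 else 1) / K.+1%:R) < 1.
  apply: prod_addV_lt1; rewrite big_split/= prodfV ltr_pdivrMr ?prodr_gt0//.
  rewrite mul1r (bigD1 j0)//= eqxx big1 ?mulr1//.
  by move=> j /negPf->.
set k1 : R := K.+1%:R => K1.
have k0 : 0 < k1 by rewrite ltr0n.
pose X := {ffun A -> 'I_K.+1}.
pose S (x : X) : R := \sum_(j | j != j0) (x j)%:R.
(* The floor reduces [S x] modulo [s]: up to rounding, [- u x j0] will be [x j0 * s] plus a
   remainder in [0, s). The floor in [n'] puts [u x j] in [x j, x j + 1), and [n x j0] is forced by
   the zero sum. *)
pose m (x : X) : int := Posz (x j0) - Num.floor (S x / s).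
pose n' (x : X) j : int := Posz (x j) - Num.floor ((m x)%:~R * b j).
pose n (x : X) j : int :=
  if j == j0 then - m x - \sum_(j | j != j0) n' x j else n' x j.
have sumn x : m x + \sum_j n x j = 0.
  rewrite (bigD1 j0)//= {1}/n eqxx.
  under [X in _ + (_ + X)]eq_bigr => j /negPf jj0 do rewrite /n jj0.
  by rewrite subrK subrr.
pose u x j : R := (m x)%:~R * b j + (n x j)%:~R.
have uE (x : X) j : j != j0 -> (x j)%:R <= u x j < (x j)%:R + 1.
  move=> /negPf jj0; rewrite /u /n jj0 /n'; move: (m x) => M.
  rewrite rmorphB/= -pmulrn.
  have /andP[] := floor_itv (M%:~R * b j); rewrite intrD => f1 f2.
  by apply/andP; split; lra.
(* Since the [b j] add up to [1 - s] and the [n x j] to [- m x], the coordinates of [u x] add up to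
   [- m x * s]. *)
have u0E (x : X) : u x j0 = - (m x)%:~R * s - \sum_(j | j != j0) u x j.
  rewrite sum_predC1 big_split/= -mulr_sumr -[\sum_j (n x j)%:~R]rmorph_sum/=.
  have -> : \sum_j n x j = - m x by apply/eqP; rewrite -addr_eq0 addrC sumn.
  have -> : \sum_j b j = 1 - s by rewrite -sb1 addrC addKr.
  rewrite /u; ring.
have u0_itv (x : X) : 0 <= - u x j0 < k1 * s + a.
  have : 0 <= \sum_(j | j != j0) u x j - S x <= #|A|%:R.
    rewrite -sumrB; apply/andP; split.
      by apply: sumr_ge0 => j /(uE x)/andP[xu _]; rewrite subr_ge0.
    apply: (@le_trans _ _ (\sum_(j | j != j0) 1)).
      by apply: ler_sum => j /(uE x)/andP[_ /ltW]; rewrite lerBlDl.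
    rewrite sumr_const ler_nat max_card//.
  rewrite u0E opprB mulNr opprK /m rmorphB/= -pmulrn.
  have /andP[] := floor_itv (S x / s); rewrite ler_pdivlMr// ltr_pdivrMr//.
  have xk : (x j0)%:R * s <= k1 * s - s.
    rewrite lerBrDr -[X in _ + X]mul1r -mulrDl ler_pM2r// natr1 ler_nat.
    exact: ltn_ord.
  have xs : 0 <= (x j0)%:R * s by rewrite mulr_ge0// ltW.
  rewrite intrD mulrDl mulrBl /a => f1 f2 /andP[f3 f4].
  by apply/andP; split; lra.
(* Coordinate [j0] of [u x] is nonpositive; flipping its sign moves all points into the box required
   by the pigeonhole lemma. *)
pose v x j := if j == j0 then - u x j else u x j.
pose w j := if j == j0 then k1 * s + a else k1.
have w0 j : 0 <= w j.
  rewrite /w; case: ifP => _; last exact: ltW.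
  by rewrite addr_ge0 ?mulr_ge0 ?ltW ?(lt_le_trans _ a1).
have vw x j : 0 <= v x j < w j.
  rewrite /v /w; case: eqVneq => [->//|jj0].
  have /andP[x1 x2] := uE x j jj0; rewrite (le_trans _ x1)//=.
  by rewrite (lt_le_trans x2)// natr1 ler_nat; exact: ltn_ord.
have [|x [y [xy xyb]]] := box_pigeonhole b0 w0 vw.
  rewrite card_ffun card_ord natrX -/k1 -prodr_const.
  rewrite -[ltRHS]mul1r -ltr_pdivrMr ?prodr_gt0//.
  rewrite -prodf_div; apply: etrans K1; congr (_ < _); apply: eq_bigr => j _.
  have k0' := lt0r_neq0 k0; have bj := lt0r_neq0 (b0 j).
  rewrite /w; by case: ifP => _; field; exact/andP.
have {v vw xyb} uxy j : `|u x j - u y j| < b j.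
  by have := xyb j; rewrite /v; case: ifP => // _; rewrite -opprD normrN.
have b1 j : b j < 1.
  rewrite -sb1 (bigD1 j)//= addrCA ltrDl ltr_pwDl// sumr_ge0// => i _.
  exact: ltW.
(* If [m x = m y], then for [j != j0] the difference of the [u] is the integer [x j - y j], of
   absolute value below [b j < 1], hence 0. Then [S x = S y], which forces [x j0 = y j0] as well. *)
have mxy : m x != m y.
  apply: contraNneq xy => mE.
  have xyj j : j != j0 -> x j = y j.
    move=> jj0; have := uxy j; rewrite /u /n (negPf jj0) /n' mE.
    move: (m y) => M; move: (Num.floor _) => c.
    have -> : M%:~R * b j + (Posz (x j) - c)%:~R
        - (M%:~R * b j + (Posz (y j) - c)%:~R)
        = (Posz (x j) - Posz (y j))%:~R :> R by rewrite !rmorphB/=; ring.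
    move=> /lt_trans/(_ (b1 j)); apply: contraTeq => xyj.
    by rewrite -leNgt norm_intr_ge1// intr_eq0 subr_eq0.
  apply/eqP/ffunP => j; have [->|/xyj//] := eqVneq j j0.
  apply/val_inj; move/eqP: mE; rewrite /m.
  have -> : S x = S y by apply: eq_bigr => i /xyj->.
  by rewrite (can_eq (subrK _)) => /eqP[].
wlog mlt : x y {xy mxy} uxy / m y < m x.
  move=> wl; move: mxy; rewrite neq_lt => /orP[mlt|]; last exact: wl uxy.
  by apply: (wl y x) => // j; rewrite distrC.
exists (m x - m y), (fun j => n x j - n y j); split=> [||j].
- by rewrite subr_gt0.
- by rewrite sumrB addrACA -opprD !sumn subrr.
- have := uxy j; rewrite /u; move: (m x) (m y) (n x j) (n y j) => M1 M2 N1 N2.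
  by rewrite !rmorphB/= mulrBl opprD addrACA.
Qed.

(** * Convex hulls and barycentric coordinates *)

Lemma convex_set_sum (R : realType) (V : lmodType R) (A : set V) (n : nat)
    (a : 'I_n.+1 -> R) (p : 'I_n.+1 -> V) :
    convex_set A -> (forall i, A (p i)) -> (forall i, 0 <= a i) ->
  \sum_i a i = 1 -> A (\sum_i a i *: p i).
Proof.
move=> cA; elim: n a p => [|n IHn] a p Ap a0.
  by rewrite !big_ord1 => ->; rewrite scale1r.
rewrite big_ord_recl [X in A X]big_ord_recl.
set S := \sum_(i < n.+1) a (lift ord0 i) => aS.
have S0 : 0 <= S by apply: sumr_ge0 => i _; exact: a0.
have a1 : a ord0 <= 1 by rewrite -aS lerDl.
have SE : S = 1 - a ord0 by rewrite -aS addrC addKr.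
(* If the tail has weight [S = 0], all its coefficients vanish. Otherwise dividing by [S] makes it a
   convex combination, and binary convexity joins it to the first point. *)
have [S00|S_neq0] := eqVneq S 0.
  have al i : a (lift ord0 i) = 0.
    by apply/eqP; move/eqP: S00; rewrite psumr_eq0// =>
      /allP/(_ i (mem_index_enum _)).
  move: aS; rewrite S00 addr0 => ->; rewrite scale1r big1 ?addr0// => i _.
  by rewrite al scale0r.
have /IHn : forall i, 0 <= a (lift ord0 i) / S by move=> i; rewrite divr_ge0.
move=> /(_ (fun i => p (lift ord0 i)) (fun i => Ap _)).
rewrite -mulr_suml divff// => /(_ erefl) Aq.
have := cA (p ord0) _ (Itv01 (a0 ord0) a1) (mem_set (Ap _)) (mem_set Aq).
rewrite inE /conv/= -[unstable.onem _]/(1 - a ord0) -SE scaler_sumr.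
congr (A (_ + _)).
by apply: eq_bigr => i _; rewrite scalerA mulrCA divff// mulr1.
Qed.

Lemma barycentric_vertex (R : realType) (V : vectType R) (m : nat)
    (p : 'I_m -> V) (i : 'I_m) :
  barycentric_coordinates p (p i) (fun j => (j == i)%:R).
Proof.
split; last by rewrite (bigD1 i)//= eqxx big1 ?addr0// => j /negPf->.
rewrite (bigD1 i)//= eqxx scale1r big1 ?addr0// => j /negPf->.
by rewrite scale0r.
Qed.

Lemma convex_hull_barycentric (R : realType) (V : vectType R) (n : nat)
    (p : 'I_n.+1 -> V) :
  convex_hull (range p) = [set y | exists2 a : 'I_n.+1 -> R,
    forall i, 0 <= a i & barycentric_coordinates p y a].
Proof.
apply/seteqP; split=> [|y [a a0 [-> a1]]]; last first.
  move=> A [cA pA]; apply: convex_set_sum => // i.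
  by apply: pA; exists i.
apply: smallest_sub.
  move=> x y l; rewrite !inE => -[a a0 [xE a1]] [c c0 [yE c1]].
  exists (fun i => l%:num * a i + (1 - l%:num) * c i) => [i|].
    by apply: addr_ge0; apply: mulr_ge0; rewrite // subr_ge0 le1.
  split; last by rewrite big_split/= -!mulr_sumr a1 c1 !mulr1 addrC subrK.
  rewrite /conv/= -[unstable.onem _]/(1 - l%:num) xE yE.
  rewrite !scaler_sumr -big_split/=; apply: eq_bigr => i _.
  by rewrite !scalerA -scalerDl.
move=> _ [i _ <-]; exists (fun j => (j == i)%:R) => [j|]; first exact: ler0n.
exact: barycentric_vertex.
Qed.

Lemma barycentric_uniq (R : realType) (V : vectType R) (m : nat)
    (p : 'I_m -> V) (y : V) (a c : 'I_m -> R) :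
    affinely_independent p ->
  barycentric_coordinates p y a -> barycentric_coordinates p y c -> a =1 c.
Proof.
move=> indep [yE a1] [yE' c1] i; apply/eqP; rewrite -subr_eq0; apply/eqP.
apply: (indep (fun i => a i - c i)); first by rewrite sumrB a1 c1 subrr.
by under eq_bigr do rewrite scalerBl; rewrite sumrB -yE -yE' subrr.
Qed.

(** * The interior of a simplex *)

Lemma barycentric_continuous (R : realType) (V : vectType R)
    (p : 'I_(dim V).+1 -> V) : affinely_independent p ->
  exists lam : vect_topology V -> 'I_(dim V).+1 -> R,
    (forall y, barycentric_coordinates p y (lam y)) /\
    (forall i, continuous (fun y => lam y i)).
Proof.
move=> indep; pose r := @v2r R V.
(* In homogeneous coordinates (1, y) the barycentric equations become the linear system
   [a *m M = hom y]. Affine independence makes the square matrix [M] invertible, so the solution is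
   affine in [y]. *)
pose hom (y : V) : 'rV[R]_(1 + dim V) := row_mx 1%:M (r y).
pose M : 'M[R]_((dim V).+1, 1 + dim V) := \matrix_i hom (p i).
have homE (a : 'rV[R]_((dim V).+1)) :
    a *m M = row_mx (\sum_i a 0 i)%:M (r (\sum_i a 0 i *: p i)).
  rewrite mulmx_sum_row; under eq_bigr do rewrite rowK [hom _]/hom scale_row_mx.
  rewrite raddf_sum /r linear_sum/=.
  elim: (index_enum _) => [|i l IHl]; first by rewrite !big_nil row_mx0.
  by rewrite !big_cons IHl add_row_mx scale_scalar_mx mulr1 linearZ.
have Mu : (M : 'M[R]_((dim V).+1)) \in unitmx.
  rewrite -row_free_unit; apply: inj_row_free => a aM0.
  have /eq_row_mx[] :=
    etrans (etrans (esym (homE a)) aM0) (esym (row_mx0 _ _ _ _)).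
  move=> /(congr1 (fun B : 'M[R]_1 => B 0 0)).
  rewrite !mxE eqxx mulr1n => a0 /eqP.
  rewrite -(linear0 (@v2r R V)) (inj_eq (@v2r_inj _ _)) => /eqP ap0.
  by apply/rowP => i; rewrite mxE (indep (fun i => a 0 i)).
exists (fun y i => (hom y *m invmx M) 0 i); split.
  move=> y; have /eq_row_mx[] : row_mx _ _ = row_mx _ _ :=
    etrans (esym (homE _)) (mulmxKV Mu (hom y)).
  move/(congr1 (fun B : 'M[R]_1 => B 0 0)); rewrite !mxE eqxx !mulr1n => a1.
  by move=> /v2r_inj.
move=> i.
pose g (B : 'rV[R]_(dim V)) :=
  \sum_(k < 1 + dim V) row_mx (1%:M : 'M[R]_1) B 0 k * invmx M k i.
have g_cont : continuous g.
  apply: continuous_big => [|k _ B]; first exact: add_continuous.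
  apply: cvgMr_tmp; first exact: nbhs_filter.
  case: (fintype.split_ordP k) => j ->.
    under eq_cvg do rewrite row_mxEl.
    by rewrite row_mxEl; apply: (@cvg_cst _ _ _ _ (nbhs_filter B)).
  under eq_cvg do rewrite row_mxEr.
  by rewrite row_mxEr; exact: coord_continuous.
have -> : (fun y => (hom y *m invmx M) 0 i) = g \o r.
  by apply/funext => y; rewrite mxE.
move=> y; apply: continuous_comp; last exact: g_cont.
exact: initial_continuous.
Qed.

(** From an interior point one can move a little along [p k - p i], for another vertex [p k], and
    stay in the hull. This lowers coordinate [i] by some [e > 0] and leaves it nonnegative. *)
Lemma interior_barycentric_gt0 (R : realType) (V : vectType R) (n : nat)
    (p : 'I_n.+1 -> V) (y : V) (a : 'I_n.+1 -> R) :
    (0 < n)%N -> affinely_independent p ->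
    vect_interior (convex_hull (range p)) y ->
  barycentric_coordinates p y a -> forall i, 0 < a i.
Proof.
move=> n0 indep yint [yE a1] i.
have [k ki] : exists k : 'I_n.+1, k != i.
  case: n n0 {p a indep yint yE a1} i => // n _ i.
  have [->|i0] := eqVneq i ord0; first by exists ord_max.
  by exists ord0; rewrite eq_sym.
pose g (e : R) : V := y + e *: (p k - p i).
have g_cont : continuous (g : R -> vect_topology V).
  apply: continuous_comp_initial.
  have -> : v2r \o g = (fun e : R => v2r y + e *: v2r (p k - p i)).
    by apply/funext => e; rewrite /= /g linearD linearZ.
  move=> e; apply: cvgD; first exact: cvg_cst.
  by apply: cvgZr_tmp; exact: cvg_id.
have g_hull : \forall e \near 0^'+, convex_hull (range p) (g e).
  apply: cvg_within; apply: (g_cont 0).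
  by rewrite /g scale0r addr0.
have [e [ghull e0]] : exists e, convex_hull (range p) (g e) /\ 0 < e.
  near (0 : R)^'+ => e; exists e; split; near: e; first exact: g_hull.
  exact: nbhs_right_gt.
move: ghull; rewrite convex_hull_barycentric => -[c c0 gc].
pose c' j := a j + e * ((j == k)%:R - (j == i)%:R).
have gc' : barycentric_coordinates p (g e) c'.
  have [pk k1] := barycentric_vertex p k.
  have [pi i1] := barycentric_vertex p i.
  split; last first.
    by rewrite big_split/= -mulr_sumr sumrB a1 k1 i1 subrr mulr0 addr0.
  rewrite /g /c' yE [in LHS]pk [in LHS]pi.
  under [RHS]eq_bigr do rewrite scalerDl -scalerA scalerBl.
  by rewrite big_split/= -scaler_sumr sumrB.
have := c0 i; rewrite (barycentric_uniq indep gc gc') /c' eqxx.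
by rewrite eq_sym (negPf ki) sub0r mulrN1 subr_ge0; exact: lt_le_trans.
Unshelve. all: by end_near. Qed.

(** By continuity, the finitely many coordinates stay positive on a neighbourhood of [y], which
    therefore lies in the hull. *)
Lemma barycentric_gt0_interior (R : realType) (V : vectType R) (d : nat)
    (p : 'I_d.+1 -> V) (y : V) (a : 'I_d.+1 -> R) :
    \dim {:V} = d -> affinely_independent p -> barycentric_coordinates p y a ->
  (forall i, 0 < a i) -> vect_interior (convex_hull (range p)) y.
Proof.
rewrite dimvf => dE; subst d => indep ya a0.
have [lam [lamP lam_cont]] := barycentric_continuous indep.
have near_gt0 i : \forall z \near (y : vect_topology V), 0 < lam z i.
  apply: (cvgr_gt _ (lam_cont i y)).
  by rewrite -(barycentric_uniq indep ya (lamP y)).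
rewrite /vect_interior /interior convex_hull_barycentric.
have : \forall z \near (y : vect_topology V), forall i, 0 < lam z i.
  exact: (filter_forall (nbhs_filter _) near_gt0).
apply: (@filterS _ _ (nbhs_filter _)) => z zgt0.
exists (lam z) => [i|]; first exact: ltW.
exact: lamP.
Qed.

(** * Closure of a lattice under integer combinations *)

Lemma lattice_add (R : realType) (V : vectType R) (r : nat) (L : set V)
    (u v : V) :
  is_lattice r L -> L u -> L v -> L (u + v).
Proof.
move=> [b _ ->] [a1 ->] [a2 ->]; exists [ffun i => a1 i + a2 i].
by rewrite -big_split; apply: eq_bigr => i _; rewrite ffunE mulrzDr.
Qed.

Lemma lattice_mulz (R : realType) (V : vectType R) (r : nat) (L : set V)
    (u : V) (c : int) :
  is_lattice r L -> L u -> L (c%:~R *: u).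
Proof.
move=> [b _ ->] [a ->]; exists [ffun i => a i * c].
rewrite scaler_sumr; apply: eq_bigr => i _.
by rewrite ffunE mulrzA scaler_int.
Qed.

(** * Construction of a second interior lattice point *)

Theorem theorem1p1 (R : realType) (d : nat) (hd : (1 <= d)%N)
    (V : vectType R) (hV : \dim {:V} = d)
    (L : set V) (hL : is_lattice d L)
    (T : set V) (p : 'I_d.+1 -> V) (hT : is_lattice_simplex L p T)
    (x : V) (hx : vect_interior T `&` L = [set x])
    (beta : 'I_d.+1 -> R) (hbeta : barycentric_coordinates p x beta)
    (I J : {set 'I_d.+1}) (hI : I != finset.set0) (hJ : J != finset.set0)
    (hdisj : [disjoint I & J]%B) (hunion : I :|: J = finset.setT) :
  \sum_(i in I) beta i >= \prod_(j in J) beta j.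
Proof.
have [[indep TE] Lp] := hT.
have [xint xL] : (vect_interior T `&` L) x by rewrite hx.
have beta0 : forall i, 0 < beta i.
  by apply: (interior_barycentric_gt0 hd indep) hbeta; rewrite -TE.
have [i0 i0I] := set0Pn _ hI; have [j0 j0J] := set0Pn _ hJ.
rewrite leNgt; apply/negP => lt_beta.
have [||||m [n [m0 mn0 box]]] :=
    @minkowski_box R 'I_#|J| (enum_rank_in j0J j0) (beta \o enum_val)
      (\sum_(i in I) beta i).
- by move=> j; exact: beta0.
- rewrite (bigD1 i0)//= ltr_pwDl// sumr_ge0// => i _; exact: ltW.
- rewrite -(big_enum_val beta) -bigU//; case: hbeta => _ <-.
  by apply: eq_bigl => i; have := finset.in_setT i; rewrite -hunion !inE.
- by rewrite -(big_enum_val beta).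
(* [c] carries the integers [n], indexed by ['I_#|J|], back to [J] and is 0 on [I]. Its sum is
   [- m], so the coefficients [gamma] add up to 1. *)
pose c i := if i \in J then n (enum_rank_in j0J i) else 0.
pose gamma i := (1 + m)%:~R * beta i + (c i)%:~R.
pose y := \sum_i gamma i *: p i.
have ygamma : barycentric_coordinates p y gamma.
  split=> //; rewrite big_split/= -mulr_sumr.
  case: hbeta => _ ->; rewrite mulr1.
  rewrite -rmorph_sum/= -rmorphD/= -big_mkcond/= big_enum_val.
  under eq_bigr do rewrite enum_valK_in.
  by rewrite -addrA mn0 addr0.
have gamma0 i : 0 < gamma i.
  rewrite /gamma /c intrD mulrDl mul1r -addrA.
  case: ifP => iJ; last by rewrite addr0 addr_gt0// mulr_gt0// ltr0z.
  have := box (enum_rank_in j0J i); rewrite /= enum_rankK_in//.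
  by rewrite ltr_norml => /andP[+ _]; rewrite -subr_gt0 opprK addrC.
have yL : L y.
  have -> : y = (1 + m)%:~R *: x + \sum_i (c i)%:~R *: p i.
    case: hbeta => -> _; rewrite scaler_sumr -big_split; apply: eq_bigr => i _.
    by rewrite scalerDl scalerA.
  apply: (lattice_add hL); first exact: lattice_mulz hL xL.
  apply: big_ind => [||i _]; last exact: lattice_mulz hL (Lp i).
    by rewrite -(scale0r x); exact: (lattice_mulz 0 hL).
  by move=> u v; exact: lattice_add hL.
have yx : y = x.
  have : (vect_interior T `&` L) y; last by rewrite hx.
  split=> //; rewrite TE.
  exact: (barycentric_gt0_interior hV indep ygamma).
(* At [i0] in [I], uniqueness of coordinates gives [(1 + m) * beta i0 = beta i0], impossible as [m]
   and [beta i0] are positive. *)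
have := barycentric_uniq indep ygamma _ i0; rewrite yx => /(_ _ hbeta).
have /negPf i0J := disjointFr hdisj i0I.
rewrite /gamma /c i0J addr0 intrD mulrDl mul1r => /eqP.
rewrite -subr_eq0 addrAC subrr add0r mulf_eq0 intr_eq0.
by rewrite !gt_eqF.
Qed.
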